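(* Let $H$ be an $n\times n$ Hadamard matrix with $n\equiv 4\pmod 8$ that has a Hall set, let $G_H$ be its Hadamard graph, and let $H'$ be a matrix obtained from $H$ by switching a Hall set. Then there exists a switching partition $\{C_1,\dots,C_t,D\}$ of the vertex set of $G_H$ (satisfying the conditions of GM-switching) such that the graph obtained from $G_H$ by GM-switching with respect to this partition is isomorphic to the Hadamard graph $G_{H'}$; that is, switching a Hall set on $H$ is equivalent to GM-switching on $G_H$.
   Context: A Hadamard matrix is a square $n\times n$ matrix $H$ with entries in $\{1,-1\}$ with $HH^T=nI$. Two Hadamard matrices are equivalent if one is obtained from the other by permuting rows and/or columns and negating rows and/or columns. Let $n\equiv 4\pmod 8$ and $m=n/4-1$. A Hadamard matrix $H$ of order $n$ has a Hall set precisely when it is equivalent to a matrix of the block form $$\begin{pmatrix} H_4 & F_1 & F_2 & F_3 & F_4\\ G_1 & A_{11}&A_{12}&A_{13}&A_{14}\\ G_2&A_{21}&A_{22}&A_{23}&A_{24}\\ G_3&A_{31}&A_{32}&A_{33}&A_{34}\\ G_4&A_{41}&A_{42}&A_{43}&A_{44}\end{pmatrix},$$ where $H_4$ is the $4\times4$ matrix with $1$ on the diagonal and $-1$ off the diagonal; $F_1,\dots,F_4$ are $4\times m$ matrices with constant rows, the rows (top to bottom) being all $1,1,1,1$ for $F_1$; all $1,-1,-1,1$ for $F_2$; all $1,-1,1,-1$ for $F_3$; all $-1,-1,1,1$ for $F_4$; $G_1=F_1^T$ and $G_j=-F_j^T$ for $j=2,3,4$; and each $A_{ij}$ is an $m\times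 m$ $\{1,-1\}$-matrix whose row and column sums all equal $2$ if $i=j$ and $0$ if $i\ne j$. (Here the first four rows form the Hall set rows and the first four columns the Hall columns.) Switching a Hall set means: bring $H$ to this form and negate $F_i$ and the corresponding $G_i$ for one $i\in\{1,2,3,4\}$; the result is again a Hadamard matrix. Hadamard graph: for an $n\times n$ $\{1,-1\}$-matrix $H$, $G_H$ has vertices $v_1,\dots,v_n,v'_1,\dots,v'_n,w_1,\dots,w_n,w'_1,\dots,w'_n$; if $h_{ij}=1$ it has edges $v_iw_j$, $v'_iw'_j$, and if $h_{ij}=-1$ edges $v_iw'_j$, $v'_iw_j$; there is a loop at every $v_i$ and $v'_i$ (a vertex with a loop counts as its own neighbour). Equivalent Hadamard matrices have isomorphic Hadamard graphs. GM-switching: a partition $\{C_1,\dots,C_t,D\}$ of the vertex set is a switching partition if (i) for all $i,j$, every vertex of $C_i$ has the same number of neighbours in $C_j$, and (ii) every vertex of $D$ has $0$, $\tfrac12|C_i|$ or $|C_i|$ neighbours in each $C_i$. GM-switching means: for every $i$ and every $v\in D$ with exactly $\tfrac12|C_i|$ neighbours in $C_i$, replace the adjacencies between $v$ and $C_i$ by their complement. *)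

(* Defs.v *)
From HB Require Import structures.
From mathcomp Require Import all_boot all_order all_fingroup all_algebra.

Set Implicit Arguments.
Unset Strict Implicit.
Unset Printing Implicit Defensive.

Import Order.TTheory GRing.Theory Num.Theory.
Local Open Scope ring_scope.

Definition sign_mx p q (M : 'M[int]_(p, q)) : Prop :=
  forall i j, M i j = 1 \/ M i j = -1.

Definition is_hadamard n (H : 'M[int]_n) : Prop :=
  sign_mx H /\ H *m H^T = n%:R%:M.

Definition hadamard_equiv n (H K : 'M[int]_n) : Prop :=
  exists (s t : 'S_n) (d e : 'I_n -> bool),
    K = \matrix_(i, j) ((-1) ^+ d i * (-1) ^+ e j * H (s i) (t j)).

Definition hall_H4 : 'M[int]_4 := \matrix_(i, j) (if i == j then 1 else -1).

(* The blocks are numbered 0, 1, 2, 3; row [k] of this table lists the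
   constant values of the four rows of the [k]-th block F. *)
Definition hall_signs : seq (seq int) :=
  [:: [:: 1;  1;  1;  1];
      [:: 1; -1; -1;  1];
      [:: 1; -1;  1; -1];
      [:: -1; -1; 1;  1] ].

Definition hall_F m (k : 'I_4) : 'M[int]_(4, m) :=
  \matrix_(i, j) nth 0 (nth [::] hall_signs k) i.

Definition hall_G m (k : 'I_4) : 'M[int]_(m, 4) :=
  if k == ord0 then (hall_F m k)^T else - (hall_F m k)^T.

Definition hall_core m (A : 'I_4 -> 'I_4 -> 'M[int]_m) : Prop :=
  forall i j : 'I_4,
    let c : int := if i == j then 2 else 0 in
    [/\ sign_mx (A i j),
        forall r, \sum_(s < m) A i j r s = c &
        forall s, \sum_(r < m) A i j r s = c].

Definition hall_block m (F : 'I_4 -> 'M[int]_(4, m))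
    (G : 'I_4 -> 'M[int]_(m, 4)) (A : 'I_4 -> 'I_4 -> 'M[int]_m) :
    'M[int]_(4 + \sum_(i < 4) m) :=
  block_mx hall_H4           (\mxrow_(j < 4) F j)
           (\mxcol_(i < 4) G i) (\mxblock_(i < 4, j < 4) A i j).

Definition hall_m (n : nat) : nat := (n %/ 4).-1.

(* For [n = 4 %[mod 8]] the equation [E] always holds, and it has only one
   proof: it merely transports the block matrix to the type ['M_n]. *)
Definition is_hall_block n (M : 'M[int]_n)
    (F : 'I_4 -> 'M[int]_(4, hall_m n)) (G : 'I_4 -> 'M[int]_(hall_m n, 4))
    (A : 'I_4 -> 'I_4 -> 'M[int]_(hall_m n)) : Prop :=
  exists E : (4 + \sum_(i < 4) hall_m n)%N = n,
    M = castmx (E, E) (hall_block F G A).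

Definition is_hall_form n (M : 'M[int]_n)
    (A : 'I_4 -> 'I_4 -> 'M[int]_(hall_m n)) : Prop :=
  hall_core A /\ is_hall_block M (@hall_F _) (@hall_G _) A.

Definition has_hall_set n (H : 'M[int]_n) : Prop :=
  exists (M : 'M[int]_n) (A : 'I_4 -> 'I_4 -> 'M[int]_(hall_m n)),
    hadamard_equiv H M /\ is_hall_form M A.

Definition negate_at p q (k : 'I_4) (B : 'I_4 -> 'M[int]_(p, q)) :
    'I_4 -> 'M[int]_(p, q) :=
  fun i => if i == k then - B i else B i.

Definition hall_switching n (H H' : 'M[int]_n) : Prop :=
  exists (M : 'M[int]_n) (A : 'I_4 -> 'I_4 -> 'M[int]_(hall_m n)) (k : 'I_4),
    [/\ hadamard_equiv H M, is_hall_form M A &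
        is_hall_block H' (negate_at k (@hall_F _)) (negate_at k (@hall_G _)) A].

(* Graphs, possibly with loops, are boolean relations on a finite type. *)

(* [inl (i, false)], [inl (i, true)], [inr (j, false)] and [inr (j, true)]
   stand for v_i, v'_i, w_j and w'_j respectively. *)
Definition hvertex (n : nat) : finType := (('I_n * bool) + ('I_n * bool))%type.

Definition hadamard_graph n (H : 'M[int]_n) : rel (hvertex n) :=
  let adj (v w : 'I_n * bool) :=
    (H v.1 w.1 == 1) && (v.2 == w.2) || (H v.1 w.1 == -1) && (v.2 != w.2) in
  fun x y => match x, y with
             | inl v, inl v' => v == v'
             | inl v, inr w | inr w, inl v => adj v w
             | inr _, inr _ => false
             end.

Definition graph_iso (T U : finType) (e : rel T) (f : rel U) : Prop :=
  exists2 h : T -> U, bijective h & forall x y, f (h x) (h y) = e x y.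

Definition nbrs_in (T : finType) (e : rel T) (x : T) (C : {set T}) : nat :=
  #|[set y in C | e x y]|.

(* [P] is the whole partition {C_1, ..., C_t, D}; the C_i are the members of
   [P :\ D]. *)
Definition switching_partition (T : finType) (e : rel T)
    (P : {set {set T}}) (D : {set T}) : Prop :=
  [/\ partition P [set: T], D \in P,
      forall C C' : {set T}, C \in P :\ D -> C' \in P :\ D ->
        {in C &, forall x y, nbrs_in e x C' = nbrs_in e y C'} &
      forall (C : {set T}) (x : T), C \in P :\ D -> x \in D ->
        [\/ nbrs_in e x C = 0%N, (2 * nbrs_in e x C = #|C|)%N
          | nbrs_in e x C = #|C| ] ].

Definition gm_flip (T : finType) (e : rel T) (P : {set {set T}})
    (D : {set T}) : rel T := fun x y =>
  (x \in D) &&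
  [exists C in P :\ D, (y \in C) && (2 * nbrs_in e x C == #|C|)%N].

Definition gm_switch (T : finType) (e : rel T) (P : {set {set T}})
    (D : {set T}) : rel T := fun x y =>
  if gm_flip e P D x y || gm_flip e P D y x then ~~ e x y else e x y.

(* Main.v *)
Require Import Defs.
From mathcomp Require Import all_boot all_order all_fingroup all_algebra.
From mathcomp Require Import zify.

(* Once H is in Hall form, the switching partition consists of the cells of
   the row blocks and of the column blocks, with D the vertices of the four
   Hall rows and columns. For the switched block k one takes a single cell
   {v_r, v'_r : r in block k} (likewise for columns); every other block is cut
   into {v_r} and {v'_r}. A vertex of D sees exactly one of each pair in a
   merged cell, hence half of it, and all or nothing of the cut ones, so that
   GM-switching negates F_k and G_k and nothing else. The cells are equitable
   because the A_ij have constant row and column sums. *)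

Set Implicit Arguments.
Unset Strict Implicit.
Unset Printing Implicit Defensive.

Import GRing.Theory Num.Theory.

(** * Switching partitions as fibres of a vertex labelling *)

Section Labelling.

Variables (T : finType) (L : eqType) (e : rel T) (c : T -> option L).

(** The label [None] marks the vertices of D; the fibres over the other labels are the cells C_i. *)
Definition same_label (x : T) : {set T} := [set y | c y == c x].

Definition label_flip : rel T := fun x y =>
  [&& c x == None, c y != None &
      2 * nbrs_in e x (same_label y) == #|same_label y|].

(** Some vertex must have label [None] because D, as a block of a partition, is nonempty. *)
Definition equitable_labelling : Prop :=
  [/\ exists x, c x = None,
      forall x y z, c x != None -> c x = c y -> c z != None ->
        nbrs_in e x (same_label z) = nbrs_in e y (same_label z) &
      forall x z, c x = None -> c z != None ->
        [\/ nbrs_in e x (same_label z) = 0,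
            2 * nbrs_in e x (same_label z) = #|same_label z|
          | nbrs_in e x (same_label z) = #|same_label z| ] ].

Let P := preim_partition c [set: T].
Let D := [set x | c x == None].

Lemma labelling_partition (C : {set T}) (x : T) : c x = None ->
  reflect (exists2 z, c z != None & C = same_label z) (C \in P :\ D).
Proof.
move=> cx; have lab z : [set y in [set: T] | c z == c y] = same_label z.
  by apply/setP => y; rewrite !inE eq_sym.
apply: (iffP setD1P) => [[nD /imsetP[z _ defC]] | [z cz ->]].
  exists z; last by rewrite defC lab.
  apply: contraNneq nD => cz.
  by apply/eqP/setP => y; rewrite defC lab !inE cz.
split; last by apply/imsetP; exists z; rewrite ?inE ?lab.
by apply: contraNneq cz => /setP/(_ z); rewrite !inE eqxx.
Qed.

Lemma labelling_switching : equitable_labelling ->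
  switching_partition e P D /\ gm_flip e P D =2 label_flip.
Proof.
case=> -[x0 cx0] eqC eqD; split.
  split; first exact: preim_partitionP.
  - apply/imsetP; exists x0; rewrite ?inE //.
    by apply/setP => y; rewrite !inE cx0 eq_sym.
  - move=> C C' /(labelling_partition _ cx0)[z cz ->].
    move=> /(labelling_partition _ cx0)[z' cz' ->] x y.
    rewrite !inE => /eqP cxz /eqP cyz.
    by apply: eqC; rewrite ?cxz // cyz.
  - move=> C x /(labelling_partition _ cx0)[z cz ->]; rewrite inE => /eqP cx.
    exact: eqD.
move=> x y; rewrite /gm_flip /label_flip inE; case: eqP => //= cx.
apply/exists_inP/andP => [[C /(labelling_partition _ cx0)[z cz ->]] | [cy hy]].
  rewrite inE => /andP[/eqP cyz]; suff -> : same_label y = same_label z.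
    by rewrite cyz.
  by apply/setP => t; rewrite !inE cyz.
exists (same_label y); first by apply/(labelling_partition _ cx0); exists y.
by rewrite inE eqxx hy.
Qed.

End Labelling.

(** * Transport along graph isomorphisms and equivalence of matrices *)

Lemma graph_iso_sym (T U : finType) (e : rel T) (f : rel U) :
  graph_iso e f -> graph_iso f e.
Proof.
case=> h [g hK gK] hE; exists g; first by exists h.
by move=> x y; rewrite -hE !gK.
Qed.

(** This serves a matrix that is only equivalent to one in Hall form: the labelling lives on the
    graph [f] of the latter and is pulled back along the isomorphism, which preserves cell sizes and
    neighbour counts. *)
Lemma labelled_gm_switch (T U : finType) (L : eqType) (e : rel T)
    (f f' : rel U) (c : U -> option L) :
    graph_iso e f -> equitable_labelling f c ->
    (forall x y, f' x y =
      if label_flip f c x y || label_flip f c y x then ~~ f x y else f x y) ->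
  exists (P : {set {set T}}) (D : {set T}),
    switching_partition e P D /\ graph_iso (gm_switch e P D) f'.
Proof.
case=> h hbij hE [[x0 cx0] eqC eqD] f'E.
pose ch := c \o h.
have cardE z : #|same_label ch z| = #|same_label c (h z)|.
  rewrite -(on_card_preimset (f := h)); last exact: onW_bij.
  by apply: eq_card => y; rewrite !inE.
have nbrsE x z : nbrs_in e x (same_label ch z) =
                 nbrs_in f (h x) (same_label c (h z)).
  rewrite /nbrs_in -[RHS](on_card_preimset (f := h)); last exact: onW_bij.
  by apply: eq_card => y; rewrite !inE hE.
have [|sw flipE] := @labelling_switching T L e ch.
  split.
  - by have [g _ gK] := hbij; exists (g x0); rewrite /ch /= gK.
  - by move=> x y z cx cxy cz; rewrite !nbrsE; apply: eqC.
  - by move=> x z cx cz; rewrite nbrsE cardE; apply: eqD.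
exists (preim_partition ch setT), [set x | ch x == None]; split=> //.
exists h => // x y; rewrite f'E /gm_switch !flipE hE.
by rewrite /label_flip !nbrsE !cardE.
Qed.

(** Permutations relabel the indices; negating row i exchanges v_i with v'_i, and negating column j
    exchanges w_j with w'_j. *)
Lemma hadamard_equiv_iso n (H M : 'M[int]_n) :
  hadamard_equiv H M -> graph_iso (hadamard_graph M) (hadamard_graph H).
Proof.
case=> s [t [d [e ->]]].
pose h (x : hvertex n) : hvertex n := match x with
  | inl v => inl (s v.1, v.2 (+) d v.1) | inr w => inr (t w.1, w.2 (+) e w.1) end.
pose g (x : hvertex n) : hvertex n := match x with
  | inl v => inl ((s^-1)%g v.1, v.2 (+) d ((s^-1)%g v.1))
  | inr w => inr ((t^-1)%g w.1, w.2 (+) e ((t^-1)%g w.1)) end.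
(* Adjacency depends only on the sign of the entry and on whether the two copies agree, so shifting
   the copies by [d1] and [e1] has the effect of multiplying the entry by both signs. *)
have adjE (a : int) (d1 e1 b b' : bool) :
    (a == 1)%R && (b (+) d1 == b' (+) e1) ||
      (a == -1)%R && (b (+) d1 != b' (+) e1) =
    ((-1) ^+ d1 * (-1) ^+ e1 * a == 1)%R && (b == b') ||
      ((-1) ^+ d1 * (-1) ^+ e1 * a == -1)%R && (b != b').
  rewrite -signr_addb mulr_sign.
  have -> : (b (+) d1 == b' (+) e1) = (b == b') (+) (d1 (+) e1).
    by case: d1; case: e1; case: b; case: b'.
  case: (d1 (+) e1); last by rewrite addbF.
  by rewrite (eqr_opp a 1%R) (eqr_oppLR a 1%R) addbT negbK orbC.
have hK : cancel h g by case=> -[i b] /=; rewrite ?permK addbK.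
exists h; first by exists g => // -[] [i b] /=; rewrite ?permKV addbK.
case=> -[i b] [] -[j b'] //=; rewrite ?mxE //.
(* Only the loops remain; they are preserved because [h] is injective. *)
exact: (inj_eq (can_inj hK) (inl (i, b)) (inl (j, b'))).
Qed.

(** * Counting neighbours in merged and split cells *)

Lemma card_sum_inl (T U : finType) (A : {set T + U}) (B : {set T}) :
  (forall x, (inl x \in A) = (x \in B)) -> (forall y, inr y \notin A) ->
  #|A| = #|B|.
Proof.
move=> Al Ar; rewrite -(card_imset _ (@inl_inj T U)); apply: eq_card.
case=> [x|y]; first by rewrite Al mem_imset //; exact: inl_inj.
by rewrite (negPf (Ar y)); apply/esym/imsetP => -[].
Qed.

Lemma card_sum_inr (T U : finType) (A : {set T + U}) (B : {set U}) :
  (forall x, inl x \notin A) -> (forall y, (inr y \in A) = (y \in B)) ->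
  #|A| = #|B|.
Proof.
move=> Al Ar; rewrite -(card_imset _ (@inr_inj T U)); apply: eq_card.
case=> [x|y]; last by rewrite Ar mem_imset //; exact: inr_inj.
by rewrite (negPf (Al x)); apply/esym/imsetP => -[].
Qed.

Section Counting.

Variables (n : nat) (I : eqType) (lab : 'I_n -> option I) (k : I).

Definition block (j : I) : {set 'I_n} := [set s | lab s == Some j].

Definition sign_adj (a : int) (b b' : bool) : bool :=
  (a == 1)%R && (b == b') || (a == -1)%R && (b != b').

(* The two copies of a block are merged for [j = k] and kept apart otherwise;
   [b] selects the copy in the latter case. *)
Definition cell (j : I) (b : bool) : {set 'I_n * bool} :=
  [set w | (w.1 \in block j) && ((j == k) || (w.2 == b))].

(** Here [f] will be a row or a column of the matrix and [b] the copy of its vertex, so that one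
    count serves both sides of the graph. *)
Definition cell_nbrs (f : 'I_n -> int) (b : bool) (j : I) (b' : bool) : nat :=
  #|[set w in cell j b' | sign_adj (f w.1) b w.2]|.

Lemma card_pairs (B : {set 'I_n}) (Q : 'I_n -> bool -> bool) :
  #|[set w : 'I_n * bool | (w.1 \in B) && Q w.1 w.2]|
    = \sum_(s in B) (Q s true + Q s false).
Proof.
rewrite -sum1dep_card -(pair_big_dep (mem B) Q (fun _ _ => 1)).
apply: eq_bigr => s _; rewrite big_mkcond big_bool.
by case: (Q s true); case: (Q s false).
Qed.

Lemma card_cell j b : #|cell j b| = (j == k).+1 * #|block j|.
Proof.
rewrite (card_pairs _ (fun _ b' => (j == k) || (b' == b))).
rewrite (eq_bigr (fun=> (j == k).+1)) ?sum_nat_const ?(mulnC #|_|) // => s _.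
by case: (j == k); case: b.
Qed.

Variable f : 'I_n -> int.
Hypothesis f_sign : forall s, f s = 1%R \/ f s = (-1)%R.

(** Whatever the sign [f s], exactly one of the two copies of [s] is a neighbour. This holds for
    every vertex on the other side, in D or not. *)
Lemma cell_nbrs_merged b b' : cell_nbrs f b k b' = #|block k|.
Proof.
rewrite /cell_nbrs -[RHS]muln1 -sum_nat_const.
rewrite -(eq_bigr _
  (fun s _ => _ : sign_adj (f s) b true + sign_adj (f s) b false = 1)).
  rewrite -(card_pairs _ (fun s => sign_adj (f s) b)).
  by apply: eq_card => w; rewrite !inE eqxx andbT.
by move=> s _; case: (f_sign s) => ->; case: b.
Qed.

(** Copy [b'] of [s] is a neighbour exactly when [f s] is the sign of [b (+) b'], so its indicator
    is half of 1 plus that sign times [f s]; the sum over the block is doubled to stay in the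
    integers. *)
Lemma cell_nbrs_split b j b' : j != k ->
  ((2 * cell_nbrs f b j b')%:Z
     = #|block j|%:Z + (-1) ^+ (b (+) b') * \sum_(s in block j) f s)%R.
Proof.
move=> jk; rewrite /cell_nbrs.
have -> : [set w in cell j b' | sign_adj (f w.1) b w.2] =
    [set w | (w.1 \in block j) && ((w.2 == b') && sign_adj (f w.1) b w.2)].
  by apply/setP => w; rewrite !inE (negPf jk) andbA.
rewrite (card_pairs _ (fun s b2 => (b2 == b') && sign_adj (f s) b b2)).
rewrite -sum1_card big_distrr mulr_sumr /= !(big_morph Posz PoszD (erefl (Posz 0))).
rewrite -big_split /=; apply: eq_bigr => s _.
by case: (f_sign s) => ->; case: b; case: b'.
Qed.

(** The sum in [cell_nbrs_split] is plus or minus the block size, which leaves nothing or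
    everything. *)
Lemma cell_nbrs_const (a : int) b j b' :
    (forall s, s \in block j -> f s = a) -> j != k ->
  cell_nbrs f b j b' = 0 \/ cell_nbrs f b j b' = #|cell j b'|.
Proof.
move=> fa jk; have := cell_nbrs_split b b' jk.
rewrite card_cell (negPf jk) mul1n.
(* Blocks may be empty; otherwise a member [s0] shows that [a] is a sign. *)
have [->|[s0 s0j]] := set_0Vmem (block j).
  by rewrite cards0 big_set0 mulr0; lia.
rewrite (eq_bigr (fun=> a) fa) sumr_const.
case: (f_sign s0) => fs0; rewrite -(fa s0) // fs0;
  by case: (b (+) b') => /=; lia.
Qed.

End Counting.

(** * The Hall labelling, for a matrix described by its block sums and constant borders *)

Section HallSwitching.

Variables (n : nat) (I : eqType) (lab : 'I_n -> option I) (k : I).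
Variables (M M' : 'M[int]_n) (a : int).

Hypothesis lab0 : exists r, lab r = None.
Hypothesis M_sign : sign_mx M.
Hypothesis M_row_const : forall r s s',
  lab r = None -> lab s = lab s' -> lab s != None -> M r s = M r s'.
Hypothesis M_col_const : forall r r' s,
  lab s = None -> lab r = lab r' -> lab r != None -> M r s = M r' s.
Hypothesis M_row_sum : forall r i j, lab r = Some i ->
  (\sum_(s in block lab j) M r s = if i == j then a else 0)%R.
Hypothesis M_col_sum : forall s i j, lab s = Some j ->
  (\sum_(r in block lab i) M r s = if i == j then a else 0)%R.
Hypothesis M'E : forall r s, M' r s =
  (if (lab r == None) && (lab s == Some k) ||
      (lab r == Some k) && (lab s == None) then - M r s else M r s)%R.

(** Hall indices get [None]. In block [k] the copy bit is erased, which merges its two copies. *)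
Definition cell_label (v : 'I_n * bool) : option (I * bool) :=
  omap (fun j => (j, (j != k) && v.2)) (lab v.1).

(** The boolean tag keeps row vertices and column vertices in different cells. *)
Definition vertex_label (x : hvertex n) : option (bool * (I * bool)) :=
  match x with
  | inl v => omap (pair false) (cell_label v)
  | inr w => omap (pair true) (cell_label w)
  end.

Lemma mem_cell w s j b : lab s = Some j ->
  (w \in cell lab k j b) = (cell_label w == cell_label (s, b)).
Proof.
rewrite /cell_label !inE /= => ->; case: (lab w.1) => [i|] //=.
rewrite -[LHS]/((Some i == Some j) && _) -[RHS]/((i, _) == (j, _)) xpair_eqE.
rewrite -[Some i == Some j]/(i == j).
by case: (eqVneq i j) => [->|//]; case: (j == k); rewrite //= ?eqxx.
Qed.

Let e := hadamard_graph M.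
Let c := vertex_label.

Lemma label_omap_neq (v w : 'I_n * bool) (b : bool) : lab w.1 != None ->
  (omap (pair b) (cell_label v) == omap (pair (~~ b)) (cell_label w)) = false.
Proof.
rewrite /cell_label; case: (lab w.1) => [j|//] _.
by case: (lab v.1) => [i|] //=; apply/eqP => -[]; case: b.
Qed.

Lemma label_omap_eq (v w : 'I_n * bool) (b : bool) :
  (omap (pair b) (cell_label v) == omap (pair b) (cell_label w))
    = (cell_label v == cell_label w).
Proof.
case: (cell_label v) => [p|]; case: (cell_label w) => [q|] //=.
by rewrite -[LHS]/((b, p) == (b, q)) xpair_eqE eqxx.
Qed.

Lemma card_same_label_inl r b i : lab r = Some i ->
  #|same_label c (inl (r, b))| = #|cell lab k i b|.
Proof.
move=> ri; apply: card_sum_inl => [v|w]; rewrite inE.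
  by rewrite /= label_omap_eq (mem_cell _ _ ri).
by rewrite (@label_omap_neq w (r, b) true) //= ri.
Qed.

Lemma card_same_label_inr s b j : lab s = Some j ->
  #|same_label c (inr (s, b))| = #|cell lab k j b|.
Proof.
move=> sj; apply: card_sum_inr => [v|w]; rewrite inE.
  by rewrite (@label_omap_neq v (s, b) false) //= sj.
by rewrite /= label_omap_eq (mem_cell _ _ sj).
Qed.

(** Row vertices are joined by loops only, so the sole candidate is [x] itself. *)
Lemma nbrs_inl_inl x r b : lab r != None ->
  nbrs_in e (inl x) (same_label c (inl (r, b))) = (c (inl x) == c (inl (r, b))).
Proof.
move=> ri; rewrite /nbrs_in.
rewrite (@card_sum_inl _ _ _
  [set y | (y == x) && (c (inl x) == c (inl (r, b)))]).
- case: (c (inl x) == _); last by apply: eq_card0 => y; rewrite inE andbF.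
  by rewrite -[RHS](cards1 x); apply: eq_card => y; rewrite !inE andbT.
- move=> y; rewrite !inE /= [x == y]eq_sym andbC.
  by case: eqP => // ->.
- by move=> y; rewrite !inE (@label_omap_neq y (r, b) true).
Qed.

Lemma nbrs_inr_inr x s b : lab s != None ->
  nbrs_in e (inr x) (same_label c (inr (s, b))) = 0.
Proof.
move=> sj; apply: eq_card0 => -[] y; rewrite !inE ?andbF //.
by rewrite (@label_omap_neq y (s, b) false).
Qed.

Lemma nbrs_inl_inr r b s b' j : lab s = Some j ->
  nbrs_in e (inl (r, b)) (same_label c (inr (s, b')))
    = cell_nbrs lab k (M r) b j b'.
Proof.
move=> sj; apply: card_sum_inr => [v|w]; rewrite inE.
  by rewrite inE (@label_omap_neq v (s, b') false) //= sj.
by rewrite [in LHS]inE /= label_omap_eq -(mem_cell _ _ sj) [in RHS]inE.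
Qed.

Lemma nbrs_inr_inl r b s b' i : lab r = Some i ->
  nbrs_in e (inr (s, b)) (same_label c (inl (r, b')))
    = cell_nbrs lab k (M^~ s) b i b'.
Proof.
move=> ri; apply: card_sum_inl => [v|w]; rewrite inE; last first.
  by rewrite inE (@label_omap_neq w (r, b') true) //= ri.
rewrite [in LHS]inE /= label_omap_eq -(mem_cell _ _ ri) [in RHS]inE /sign_adj.
by rewrite [v.2 == _]eq_sym.
Qed.

(* For [i = k] the copies [b] and [b'] may differ; this is harmless because
   the sums over the blocks [j != k] then vanish. *)
Lemma cell_nbrs_eq (f g : 'I_n -> int) b b' i j b2 :
    (forall s, f s = 1 \/ f s = -1)%R -> (forall s, g s = 1 \/ g s = -1)%R ->
    (\sum_(s in block lab j) f s = if i == j then a else 0)%R ->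
    (\sum_(s in block lab j) g s = if i == j then a else 0)%R ->
    (i != k) && b = (i != k) && b' ->
  cell_nbrs lab k f b j b2 = cell_nbrs lab k g b' j b2.
Proof.
move=> fs gs sf sg; have [->|jk] := eqVneq j k.
  by rewrite !cell_nbrs_merged.
have := cell_nbrs_split lab fs b b2 jk.
have := cell_nbrs_split lab gs b' b2 jk.
rewrite sf sg; have [->|ik] := eqVneq i k.
  by rewrite [k == j]eq_sym (negPf jk) !mulr0; lia.
by move=> + + /= bb; rewrite bb; lia.
Qed.

(** Since [s0] makes the cell nonempty, half of it is neither nothing nor everything; hence the half
    case singles out block [k]. *)
Lemma cell_nbrs_hall (f : 'I_n -> int) b j b' s0 :
    (forall s, f s = 1 \/ f s = -1)%R -> lab s0 = Some j ->
    (forall s, s \in block lab j -> f s = f s0) ->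
  [/\ [\/ cell_nbrs lab k f b j b' = 0,
          2 * cell_nbrs lab k f b j b' = #|cell lab k j b'|
        | cell_nbrs lab k f b j b' = #|cell lab k j b'| ] &
      (2 * cell_nbrs lab k f b j b' == #|cell lab k j b'|) = (j == k)].
Proof.
move=> fs s0j fc.
have cell_gt0 : 0 < #|cell lab k j b'|.
  rewrite card_cell muln_gt0 /=; apply/card_gt0P; exists s0.
  by rewrite inE s0j.
have [jk|jk] := eqVneq j k.
  have half : 2 * cell_nbrs lab k f b j b' = #|cell lab k j b'|.
    by rewrite card_cell jk cell_nbrs_merged ?eqxx.
  by split; [apply: Or32 | apply/eqP].
by have [->|->] := cell_nbrs_const fs b b' fc jk;
  split; (try by [apply: Or31 | apply: Or33]); lia.
Qed.

Lemma M_row_hall r b s b' j : lab r = None -> lab s = Some j ->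
  [/\ [\/ cell_nbrs lab k (M r) b j b' = 0,
          2 * cell_nbrs lab k (M r) b j b' = #|cell lab k j b'|
        | cell_nbrs lab k (M r) b j b' = #|cell lab k j b'| ] &
      (2 * cell_nbrs lab k (M r) b j b' == #|cell lab k j b'|) = (j == k)].
Proof.
move=> r0 sj; apply: cell_nbrs_hall (sj) _ => // s'; rewrite inE => /eqP sj'.
by apply: M_row_const; rewrite ?sj'.
Qed.

Lemma M_col_hall r b s b' i : lab s = None -> lab r = Some i ->
  [/\ [\/ cell_nbrs lab k (M^~ s) b i b' = 0,
          2 * cell_nbrs lab k (M^~ s) b i b' = #|cell lab k i b'|
        | cell_nbrs lab k (M^~ s) b i b' = #|cell lab k i b'| ] &
      (2 * cell_nbrs lab k (M^~ s) b i b' == #|cell lab k i b'|) = (i == k)].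
Proof.
move=> s0 ri; apply: cell_nbrs_hall (ri) _ => // r'; rewrite inE => /eqP ri'.
by apply: M_col_const; rewrite ?ri'.
Qed.

Lemma label_neqN x :
  (c x != None) = (lab (match x with inl v => v.1 | inr w => w.1 end) != None).
Proof. by case: x => -[r b]; rewrite /= /cell_label /=; case: (lab r). Qed.

Lemma label_None x :
  c x = None -> lab (match x with inl v => v.1 | inr w => w.1 end) = None.
Proof. by case: x => -[r b]; rewrite /= /cell_label /=; case: (lab r). Qed.

(** Within a side only loops count, and equally labelled vertices agree on them. Across sides the
    count is governed by the row and column sums, common to a block. The loop at a vertex of D stays
    inside D. *)
Lemma vertex_label_equitable : equitable_labelling e c.
Proof.
split.
- by have [r r0] := lab0; exists (inl (r, false)); rewrite /= /cell_label /= r0.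
- move=> x y z cx cxy cz; rewrite label_neqN in cz.
  case: x cx cxy => -[r b] cx; case: y => -[r' b'] cxy.
  + case: z cz => -[s b2]; case sj: (lab s) => [j|] //= _.
      by rewrite !nbrs_inl_inl ?sj // cxy.
    rewrite !(nbrs_inl_inr _ _ _ sj).
    move: cx cxy; rewrite /= /cell_label /=.
    case ri: (lab r) => [i|] //= _.
    case ri': (lab r') => [i'|] //= [ii bb]; subst i'.
    by apply: cell_nbrs_eq (M_row_sum _ ri) (M_row_sum _ ri') bb.
  + by move: cx cxy; rewrite /= /cell_label /=; case: (lab r) => // i _; case: (lab r').
  + by move: cx cxy; rewrite /= /cell_label /=; case: (lab r) => // i _; case: (lab r').
  + case: z cz => -[s b2]; case sj: (lab s) => [j|] //= _; last first.
      by rewrite !nbrs_inr_inr ?sj.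
    rewrite !(nbrs_inr_inl _ _ _ sj).
    move: cx cxy; rewrite /= /cell_label /=.
    case ri: (lab r) => [i|] //= _.
    case ri': (lab r') => [i'|] //= [ii bb]; subst i'.
    have sumE s' : lab s' = Some i ->
        (\sum_(t in block lab j) M t s' = if i == j then a else 0)%R.
      by rewrite eq_sym; exact: M_col_sum.
    by apply: cell_nbrs_eq (sumE _ ri) (sumE _ ri') bb.
- move=> x z cx; rewrite label_neqN; have xN := label_None cx.
  case: x cx xN => -[r b] /= cx r0; case: z => -[s b'] /=;
    case sj: (lab s) => [j|] // _.
  + by apply: Or31; rewrite nbrs_inl_inl ?sj //= cx /cell_label /= sj.
  + rewrite (nbrs_inl_inr _ _ _ sj) (card_same_label_inr _ sj).
    by case: (M_row_hall b b' r0 sj).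
  + rewrite (nbrs_inr_inl _ _ _ sj) (card_same_label_inl _ sj).
    by case: (M_col_hall b b' r0 sj).
  + by apply: Or31; rewrite nbrs_inr_inr ?sj.
Qed.

Lemma label_flip_inl_inr r b s b' :
  label_flip e c (inl (r, b)) (inr (s, b'))
    = (lab r == None) && (lab s == Some k).
Proof.
rewrite /label_flip label_neqN -[c _ == None]negbK label_neqN negbK /=.
case: eqP => //= r0; case sj: (lab s) => [j|] //=.
rewrite (nbrs_inl_inr _ _ _ sj) (card_same_label_inr _ sj).
by have [_ ->] := M_row_hall b b' r0 sj.
Qed.

Lemma label_flip_inr_inl r b s b' :
  label_flip e c (inr (s, b)) (inl (r, b'))
    = (lab s == None) && (lab r == Some k).
Proof.
rewrite /label_flip label_neqN -[c _ == None]negbK label_neqN negbK /=.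
case: eqP => //= s0; case ri: (lab r) => [i|] //=.
rewrite (nbrs_inr_inl _ _ _ ri) (card_same_label_inl _ ri).
by have [_ ->] := M_col_hall b b' s0 ri.
Qed.

(** A vertex of D has no neighbour in a cell on its own side, and 0 is not half of a cell that
    contains [y]. *)
Lemma label_flip_same_side x y :
  (if x is inl _ then true else false)
    = (if y is inl _ then true else false) ->
  label_flip e c x y = false.
Proof.
move=> xy; apply/negP => /and3P[/eqP cx cy].
suff -> : nbrs_in e x (same_label c y) = 0.
  rewrite muln0 eq_sym cards_eq0 => /eqP/setP/(_ y).
  by rewrite !inE eqxx.
rewrite label_neqN in cy.
case: x cx xy => x cx; case: y cy => -[s b] //= cy _; last exact: nbrs_inr_inr.
by rewrite nbrs_inl_inl // cx /= /cell_label /=; case: (lab s) cy.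
Qed.

Lemma switched_graph x y : hadamard_graph M' x y =
  if label_flip e c x y || label_flip e c y x then ~~ e x y else e x y.
Proof.
(* Negating an entry equal to 1 or -1 complements the adjacency between all copies of its row and
   column. *)
have adjN r s b b' : sign_adj (M' r s) b b' =
    if (lab r == None) && (lab s == Some k) ||
       (lab s == None) && (lab r == Some k)
    then ~~ sign_adj (M r s) b b' else sign_adj (M r s) b b'.
  rewrite M'E [(lab r == Some _) && _]andbC; case: ifP => // _.
  by case: (M_sign r s) => ->; rewrite /sign_adj; case: b; case: b'.
case: x => -[r b]; case: y => -[s b'].
- by rewrite !label_flip_same_side.
- by rewrite label_flip_inl_inr label_flip_inr_inl; apply: adjN.
- by rewrite label_flip_inl_inr label_flip_inr_inl orbC; apply: adjN.
- by rewrite !label_flip_same_side.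
Qed.

Lemma labelled_hall_switching (H : 'M[int]_n) : hadamard_equiv H M ->
  exists (P : {set {set hvertex n}}) (D : {set hvertex n}),
    switching_partition (hadamard_graph H) P D /\
    graph_iso (gm_switch (hadamard_graph H) P D) (hadamard_graph M').
Proof.
move=> /hadamard_equiv_iso/graph_iso_sym HM.
exact: labelled_gm_switch HM vertex_label_equitable switched_graph.
Qed.

End HallSwitching.

(** * The block matrix in Hall form *)

Section HallBlock.

Variable m : nat.
Local Notation N := (4 + \sum_(i < 4) m).

(** The first four indices are the Hall ones; for the others [tagnat.sig1] recovers the block number
    from the flattened index. *)
Definition hall_label (r : 'I_N) : option 'I_4 :=
  if split r is inr q then Some (tagnat.sig1 q) else None.

Lemma hall_label_lshift r : hall_label (lshift _ r) = None.
Proof. by rewrite /hall_label (unsplitK (inl r)). Qed.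

Lemma hall_label_rshift q : hall_label (rshift 4 q) = Some (tagnat.sig1 q).
Proof. by rewrite /hall_label (unsplitK (inr q)). Qed.

Lemma sum_hall_block (f : 'I_N -> int) (g : 'I_4 -> 'I_m -> int) j :
    (forall q, f (rshift 4 q) = g (tagnat.sig1 q) (tagnat.sig2 q)) ->
  (\sum_(s in block hall_label j) f s = \sum_(u < m) g j u)%R.
Proof.
move=> fg; rewrite big_split_ord /= big_pred0 => [|r]; last first.
  by rewrite inE hall_label_lshift.
(* The right side becomes a sum over pairs of a block number and a position, restricted to block
   [j], so that the bijection [tagnat.sig] matches it with the left side. *)
rewrite add0r -[RHS](big_pred1_eq +%R j (fun i => \sum_(u < m) g i u)%R).
rewrite sig_big_dep [RHS](reindex (@tagnat.sig _ _)) /=; last first.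
  exact: onW_bij tagnat.sig_bij.
apply: eq_big => q; first by rewrite inE hall_label_rshift andbT.
by move=> _; rewrite fg.
Qed.

Variables (A : 'I_4 -> 'I_4 -> 'M[int]_m) (k : 'I_4).
Hypothesis A_core : hall_core A.

Let M := hall_block (@hall_F m) (@hall_G m) A.
Let M' := hall_block (negate_at k (@hall_F m)) (negate_at k (@hall_G m)) A.

Let entry := (block_mxEul, block_mxEur, block_mxEdl, block_mxEdr, mxE).

Lemma hall_F_sign (j : 'I_4) : sign_mx (hall_F m j).
Proof.
move=> r s; rewrite mxE; case: j => -[|[|[|[|//]]]] ?;
  by case: r => -[|[|[|[|//]]]] ? /=; auto.
Qed.

Lemma hall_G_sign (i : 'I_4) : sign_mx (hall_G m i).
Proof.
move=> r s; rewrite /hall_G; case: ifP => _; rewrite !mxE.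
  by have := hall_F_sign i s r; rewrite mxE.
by have := hall_F_sign i s r; rewrite mxE => -[->|->]; [right | left].
Qed.

Lemma hall_block_sign : sign_mx M.
Proof.
move=> r s; case: (split_ordP r) => q ->; case: (split_ordP s) => t ->;
  rewrite /M /hall_block !entry.
- by case: ifP; auto.
- by have := hall_F_sign (tagnat.sig1 t) q (tagnat.sig2 t); rewrite mxE.
- exact: hall_G_sign.
- by have [+ _ _] := A_core (tagnat.sig1 q) (tagnat.sig1 t).
Qed.

Lemma hall_block_switching (H : 'M[int]_N) : hadamard_equiv H M ->
  exists (P : {set {set hvertex N}}) (D : {set hvertex N}),
    switching_partition (hadamard_graph H) P D /\
    graph_iso (gm_switch (hadamard_graph H) P D) (hadamard_graph M').
Proof.
(* The constant 2 is the row and column sum of the diagonal blocks of the core. *)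
apply: (@labelled_hall_switching _ _ hall_label k M M' 2%R).
- by exists (lshift _ ord0); rewrite hall_label_lshift.
- exact: hall_block_sign.
- move=> r s s'; case: (split_ordP r) => q ->; last by rewrite hall_label_rshift.
  case: (split_ordP s) => t ->; case: (split_ordP s') => t' ->;
    rewrite ?hall_label_lshift ?hall_label_rshift // => _ [tt'] _.
  by rewrite /M /hall_block !entry tt'.
- move=> r r' s; case: (split_ordP s) => q ->; last by rewrite hall_label_rshift.
  case: (split_ordP r) => t ->; case: (split_ordP r') => t' ->;
    rewrite ?hall_label_lshift ?hall_label_rshift // => _ [tt'] _.
  rewrite /M /hall_block !entry /hall_G tt'.
  by case: ifP => _; rewrite !mxE.
- move=> r i j; case: (split_ordP r) => q ->; first by rewrite hall_label_lshift.
  rewrite hall_label_rshift => -[<-].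
  rewrite (@sum_hall_block _
    (fun j' u => A (tagnat.sig1 q) j' (tagnat.sig2 q) u)) => [|t].
    by have [_ + _] := A_core (tagnat.sig1 q) j; exact.
  by rewrite /M /hall_block !entry.
- move=> s i j; case: (split_ordP s) => q ->; first by rewrite hall_label_lshift.
  rewrite hall_label_rshift => -[<-].
  rewrite (@sum_hall_block _
    (fun i' u => A i' (tagnat.sig1 q) u (tagnat.sig2 q))) => [|t].
    by have [_ _ +] := A_core i (tagnat.sig1 q); exact.
  by rewrite /M /hall_block !entry.
(* The corner [hall_H4] and the core are common to both matrices; only the borders of block [k]
   change sign. *)
- move=> r s; case: (split_ordP r) => q ->; case: (split_ordP s) => t ->;
    rewrite ?hall_label_lshift ?hall_label_rshift ?andbF ?orbF;
    rewrite /M /M' /hall_block !entry //=.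
  + by rewrite /negate_at -[Some _ == Some _]/(_ == k); case: ifP; rewrite !mxE.
  + rewrite andbT /negate_at -[Some _ == Some _]/(_ == k).
    by case: ifP; rewrite ?mxE.
Qed.

End HallBlock.

Theorem theorem3p4 (n : nat) (H H' : 'M[int]_n)
    (hn : n = 4 %[mod 8]) (hH : is_hadamard H) (hHall : has_hall_set H)
    (hsw : hall_switching H H') :
  exists (P : {set {set hvertex n}}) (D : {set hvertex n}),
    switching_partition (hadamard_graph H) P D /\
    graph_iso (gm_switch (hadamard_graph H) P D) (hadamard_graph H').
Proof.
have [M [A [k [HM [A_core [E defM]] [E' ->]]]]] := hsw.
(* Equality proofs in [nat] are unique, so both block matrices are cast along the same [E]. *)
rewrite {}defM (eq_irrelevance E' E) in HM *.
(* The block size [hall_m n] depends on [n]; it is generalised to [m] so that [E] can be eliminated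
   and the casts vanish. *)
move: (hall_m n) E {E'} A A_core HM => m E A A_core.
move: H {H' hn hH hHall hsw M}; case: n / E => H; rewrite !castmx_id.
exact: hall_block_switching.
Qed.
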